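(* Let $\delta\ge0$ and let $\mathcal C,\mathcal D$ be barcodes. An overlap matching of barcodes $f:\mathcal C\to\mathcal D(\delta)$ is a $\delta$-interleaving morphism if and only if $r_\delta\circ f:\mathcal C\to\mathcal D$ is a $\delta$-matching. In particular, for any barcodes $\mathcal C$ and $\mathcal D$, $$d_I(\mathcal C,\mathcal D)=d_B(\mathcal C,\mathcal D).$$
   Context: An interval is a non-empty set $I\subseteq\mathbb R$ such that $a,c\in I$ and $a<b<c$ imply $b\in I$. A barcode is a multiset representation of intervals: a subset of $S\times X$ where $S$ is a set of intervals and $X$ is any set (of indices). An element $(I,x)$ is usually written simply $I$. A matching is a partial injective function; matchings are composed ($\circ$) as relations. For intervals $I,J$: $I$ overlaps $J$ above if $I\cap J\neq\emptyset$, for all $s\in J$ there is $t\in I$ with $s\le t$, and for all $t\in I$ there is $s\in J$ with $s\le t$. An overlap matching $\sigma:\mathcal C\to\mathcal D$ of barcodes is a matching such that $\sigma(I)=J$ implies that $I$ overlaps $J$ above. $\mathbf{Barc}$ is the category of barcodes and overlap matchings with composition $\tau\bullet\sigma=\{(I,K)\in\tau\circ\sigma\mid I\text{ overlaps }K\text{ above}\}$. For an interval $I$ and $\delta\in\mathbb R$, $I(\delta)=\{t\mid t+\delta\in I\}$; for a barcode $\mathcal C$, $\mathcal C(\delta)=\{I(\delta)\mid I\in\mathcal C\}$ (with the same indices); an overlap matching $f:\mathcal C\to\mathcal D$ induces $f(\delta):\mathcal C(\delta)\to\mathcal D(\delta)$. $r_\delta:\mathcal D(\delta)\to\mathcal D$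 is the obvious bijection $I(\delta)\mapsto I$. An interval is called $\delta$-trivial if it is contained in some half-open interval of length $\delta$. For $\delta\ge0$, $S^{\mathcal C,\delta}:\mathcal C\to\mathcal C(\delta)$ is the overlap matching $\{(I,I(\delta))\mid I\in\mathcal C\text{ is not }\delta\text{-trivial}\}$. A $\delta$-interleaving between barcodes $\mathcal C,\mathcal D$ is a pair of overlap matchings $f:\mathcal C\to\mathcal D(\delta)$, $g:\mathcal D\to\mathcal C(\delta)$ with $g(\delta)\bullet f=S^{\mathcal C,2\delta}$ and $f(\delta)\bullet g=S^{\mathcal D,2\delta}$; then $f$ and $g$ are called $\delta$-interleaving morphisms. $d_I(\mathcal C,\mathcal D)=\inf\{\delta\ge0\mid\text{there is a }\delta\text{-interleaving between }\mathcal C\text{ and }\mathcal D\}$. For an interval $I$ and $\delta\ge0$, $U_\delta(I)=\{t\in\mathbb R\mid\exists\,s\in I\text{ with }|s-t|\le\delta\}$. A $\delta$-matching between barcodes $\mathcal C$ and $\mathcal D$ is a (not necessarily overlap) matching $\sigma:\mathcal C\to\mathcal D$ such that (i) $\sigma$ matches each interval in $\mathcal C\cup\mathcal D$ that is not $2\delta$-trivial, and (ii) if $\sigma(I)=J$, then $I\subseteq U_\delta(J)$ and $J\subseteq U_\delta(I)$. The bottleneck distance is $d_B(\mathcal C,\mathcal D)=\inf\{\delta\ge0\mid\exists\text{ a }\delta\text{-matching between }\mathcal C\text{ and }\mathcal D\}$. Infima of empty sets are $\infty$. *)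

(* Defs.v *)
From HB Require Import structures.
From mathcomp Require Import all_boot all_order all_algebra.
From mathcomp Require Import all_classical all_reals all_analysis.

Set Implicit Arguments.
Unset Strict Implicit.
Unset Printing Implicit Defensive.

Import Order.TTheory GRing.Theory Num.Theory.
Import numFieldNormedType.Exports.

Local Open Scope classical_set_scope.
Local Open Scope ring_scope.

Record interval_set (R : realType) := IntervalSet {
  points : set R;
  points_nonempty : points !=set0;
  points_interval : is_interval points }.

Section Intervals.
Variable R : realType.
Implicit Types (I J : interval_set R) (d : R).

Definition overlaps_above I J : Prop :=
  [/\ (points I `&` points J) !=set0,
      forall s, points J s -> exists2 t, points I t & s <= t &
      forall t, points I t -> exists2 s, points J s & s <= t].

Lemma shift_nonempty d I : [set t | points I (t + d)] !=set0.
Proof. by have [t It] := points_nonempty I; exists (t - d); rewrite /= subrK. Qed.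

Lemma shift_interval d I : is_interval [set t | points I (t + d)].
Proof.
move=> a c Ia Ic b /andP[ab bc].
by apply: (points_interval Ia Ic); rewrite !lerD2r ab bc.
Qed.

Definition shift_interval_set d I : interval_set R :=
  IntervalSet (@shift_nonempty d I) (@shift_interval d I).

(* For d = 0 the half-open intervals are empty, so no interval is 0-trivial. *)
Definition trivial_interval d I : Prop :=
  exists a, points I `<=` `[a, (a + d)[%classic \/
            points I `<=` `]a, (a + d)]%classic.

Definition thickening d I : set R :=
  [set t | exists2 s, points I s & `|s - t| <= d].

End Intervals.

(* A bar is an interval together with its index. *)
Definition bar (R : realType) (X : Type) : Type := (interval_set R * X)%type.

Definition barcode (R : realType) (X : Type) : Type := set (bar R X).

Definition is_matching (T U : Type) (C : set T) (D : set U) (sigma : set (T * U))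
    : Prop :=
  [/\ sigma `<=` C `*` D,
      forall b c c', sigma (b, c) -> sigma (b, c') -> c = c' &
      forall b b' c, sigma (b, c) -> sigma (b', c) -> b = b'].

Section Barcodes.
Variable R : realType.

Definition overlap_matching (X Y : Type) (C : barcode R X) (D : barcode R Y)
    (sigma : set (bar R X * bar R Y)) : Prop :=
  is_matching C D sigma /\
  forall b c, sigma (b, c) -> overlaps_above b.1 c.1.

(* [tau \; sigma] relates p.1 to p.2 when sigma relates p.1 to some z and tau
   relates z to p.2, i.e. sigma is applied first. *)
Definition overlap_comp (X Y Z : Type) (tau : set (bar R Y * bar R Z))
    (sigma : set (bar R X * bar R Y)) : set (bar R X * bar R Z) :=
  [set p | (tau \; sigma)%relation p /\ overlaps_above p.1.1 p.2.1].

Definition shift_bar (X : Type) (d : R) (b : bar R X) : bar R X :=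
  (shift_interval_set d b.1, b.2).

Definition shift_barcode (X : Type) (d : R) (C : barcode R X) : barcode R X :=
  shift_bar d @` C.

Definition shift_matching (X Y : Type) (d : R)
    (f : set (bar R X * bar R Y)) : set (bar R X * bar R Y) :=
  [set (shift_bar d p.1, shift_bar d p.2) | p in f].

(* The bijection r_d : D(d) -> D, as a relation. *)
Definition unshift (X : Type) (d : R) (D : barcode R X)
    : set (bar R X * bar R X) :=
  [set (shift_bar d b, b) | b in D].

(* The overlap matching S^(C,d) : C -> C(d). *)
Definition transition (X : Type) (C : barcode R X) (d : R)
    : set (bar R X * bar R X) :=
  [set (b, shift_bar d b) | b in [set b | C b /\ ~ trivial_interval d b.1]].

Definition interleaving (X Y : Type) (d : R) (C : barcode R X) (D : barcode R Y)
    (f : set (bar R X * bar R Y)) (g : set (bar R Y * bar R X)) : Prop :=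
  [/\ overlap_matching C (shift_barcode d D) f,
      overlap_matching D (shift_barcode d C) g,
      overlap_comp (shift_matching d g) f = transition C (2 * d) &
      overlap_comp (shift_matching d f) g = transition D (2 * d)].

(* The definition of an interleaving is symmetric under exchanging (C, f) and
   (D, g), so this also covers the second component of an interleaving. *)
Definition interleaving_morphism (X Y : Type) (d : R) (C : barcode R X)
    (D : barcode R Y) (f : set (bar R X * bar R Y)) : Prop :=
  exists g : set (bar R Y * bar R X), interleaving d C D f g.

Definition delta_matching (X Y : Type) (d : R) (C : barcode R X)
    (D : barcode R Y) (sigma : set (bar R X * bar R Y)) : Prop :=
  [/\ is_matching C D sigma,
      forall b, C b -> ~ trivial_interval (2 * d) b.1 ->
        exists c, sigma (b, c),
      forall c, D c -> ~ trivial_interval (2 * d) c.1 ->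
        exists b, sigma (b, c) &
      forall b c, sigma (b, c) ->
        points b.1 `<=` thickening d c.1 /\
        points c.1 `<=` thickening d b.1].

(* The infimum of the empty set in [\bar R] is +oo. *)
Definition interleaving_distance (X Y : Type) (C : barcode R X)
    (D : barcode R Y) : \bar R :=
  ereal_inf [set d%:E | d in
    [set d : R | 0 <= d /\ exists f g, interleaving d C D f g]].

Definition bottleneck_distance (X Y : Type) (C : barcode R X)
    (D : barcode R Y) : \bar R :=
  ereal_inf [set d%:E | d in
    [set d : R | 0 <= d /\ exists sigma, delta_matching d C D sigma]].

End Barcodes.

(* Main.v *)
(** An interval is not e-trivial exactly when it contains two points p and p +
e, equivalently when it overlaps its shift by e above. If f and g interleave
and f matches I to J(d), with I or J not 2d-trivial, then g matches J to I(d),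
and the two overlaps bound the endpoints of I and J against each other; if both
are 2d-trivial their shortness does the same. Conversely, a d-matching is
turned into an interleaving by keeping, in each direction, the pairs that
overlap after the shift: this discards only pairs of 2d-trivial intervals,
because a nontrivial interval and its partner overlap in both directions. *)

Require Import Defs.
From mathcomp Require Import all_boot all_order all_algebra.
From mathcomp Require Import all_classical all_reals all_analysis.
From mathcomp Require Import lra.

Set Implicit Arguments.
Unset Strict Implicit.
Unset Printing Implicit Defensive.

Import Order.TTheory GRing.Theory Num.Theory.

Local Open Scope classical_set_scope.
Local Open Scope ring_scope.

(** * Triviality, thickenings and overlaps of single intervals *)

Section Intervals.
Variable R : realType.
Implicit Types (I J : interval_set R) (d e t : R).

Lemma interval_set_eq I J : points I = points J -> I = J.
Proof.
case: I J => [A A0 Ai] [B B0 Bi] /= AB; subst B.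
by rewrite (Prop_irrelevance A0 B0) (Prop_irrelevance Ai Bi).
Qed.

Lemma shift_interval_setD d e I :
  shift_interval_set d (shift_interval_set e I) = shift_interval_set (d + e) I.
Proof. by apply/interval_set_eq/funext => t /=; rewrite addrA. Qed.

Lemma shift_interval_set0 I : shift_interval_set 0 I = I.
Proof. by apply/interval_set_eq/funext => t /=; rewrite addr0. Qed.

Lemma shift_interval_set_inj d : injective (@shift_interval_set R d).
Proof.
move=> I J /(congr1 (@shift_interval_set R (- d))).
by rewrite !shift_interval_setD addNr !shift_interval_set0.
Qed.

(** If no such [p] exists, convexity forces every point to lie strictly less than [d] above every
    other, so the infimum is the left end of a half-open interval of length [d]. Which end is open
    depends on whether the infimum is attained: if it is, the bound at the right end is strict; if
    not, that bound may be an equality but the left end is excluded. *)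
Lemma not_trivial_intervalP d I : 0 <= d ->
  ~ trivial_interval d I <-> exists2 p, points I p & points I (p + d).
Proof.
move=> d0; split; last first.
  move=> [p Ip Ipd] [a [] sub]; have := sub _ Ip; have := sub _ Ipd;
    rewrite /= !in_itv /= => /andP[? ?] /andP[? ?]; lra.
move=> ntriv; apply: contrapT => nex; apply: ntriv.
have gap p t : points I p -> points I t -> t < p + d.
  move=> Ip It; rewrite ltNge; apply/negP => pdt; apply: nex; exists p => //.
  by apply: (points_interval Ip It); rewrite pdt andbT lerDl.
have [q Iq] := points_nonempty I.
have lbI : has_lbound (points I).
  by exists (q - d) => t It; rewrite lerBlDr ltW // gap.
exists (inf (points I)).
have [Iinf|nIinf] := pselect (points I (inf (points I))).
  left => t It; rewrite /= in_itv /= gap // andbT.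
  exact: (ge_inf lbI It).
right => t It; rewrite /= in_itv /=; apply/andP; split.
  rewrite lt_neqAle (ge_inf lbI It) andbT.
  by apply/eqP => tE; apply: nIinf; rewrite tE.
rewrite -lerBlDr; apply: lb_le_inf; first exact: points_nonempty.
by move=> s Is; rewrite lerBlDr ltW // gap.
Qed.

(** The witness is the larger of [a] and [t - d]; in the second case it lies in [J] by convexity. *)
Lemma thickening_between d J t a b : 0 <= d -> points J a -> points J b ->
  a <= t + d -> t - d <= b -> thickening d J t.
Proof.
move=> d0 Ja Jb atd tdb.
have [ta|at_] := leP (t - d) a.
  by exists a => //; rewrite ler_norml; apply/andP; split; lra.
exists (t - d); last by rewrite ler_norml; apply/andP; split; lra.
by apply: (points_interval Ja Jb); rewrite tdb andbT ltW.
Qed.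

(* If [I] and [J] are both 2d-trivial, then the points of each are within 2d of
   one another, so a common point of [I] and [J(d)] bounds the two intervals on
   the side that the overlap leaves free. *)
Lemma overlaps_above_thickening d I J : 0 <= d ->
  overlaps_above I (shift_interval_set d J) ->
  (~ trivial_interval (2 * d) I \/ ~ trivial_interval (2 * d) J ->
     overlaps_above J (shift_interval_set d I)) ->
  points I `<=` thickening d J /\ points J `<=` thickening d I.
Proof.
move=> d0 [[p [Ip /= Jp]] JI IJ] back.
have [/back [_ IJ' JI']|] := pselect
    (~ trivial_interval (2 * d) I \/ ~ trivial_interval (2 * d) J).
  (* One overlap gives a point of the other interval at most [t + d], the reverse overlap gives one
     at least [t - d]. *)
  split=> t Kt.
    have [s /= Js st] := IJ _ Kt.
    have [|u Ju ut] := IJ' (t - d); first by rewrite /= subrK.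
    by apply: (thickening_between d0 Js Ju) => //; rewrite lerD2r.
  have [s /= Is st] := JI' _ Kt.
  have [|u Iu ut] := JI (t - d); first by rewrite /= subrK.
  by apply: (thickening_between d0 Is Iu) => //; rewrite lerD2r.
move/not_orP => [/contrapT trivI /contrapT trivJ].
have dd0 : 0 <= 2 * d by lra.
have gap K (trivK : trivial_interval (2 * d) K) x y :
    points K x -> points K y -> y <= x + 2 * d.
  move=> Kx Ky; rewrite leNgt; apply/negP => lt_y.
  apply: (proj2 (not_trivial_intervalP K dd0)) trivK; exists x => //.
  by apply: (points_interval Kx Ky); rewrite (ltW lt_y) andbT lerDl.
split=> t Kt.
  have [s /= Js st] := IJ _ Kt.
  apply: (thickening_between d0 Js Jp); first by rewrite lerD2r.
  by have := gap _ trivI _ _ Ip Kt; lra.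
have [|u Iu ut] := JI (t - d); first by rewrite /= subrK.
apply: (thickening_between d0 Ip Iu) => //.
by have := gap _ trivJ _ _ Kt Jp; lra.
Qed.

(** The two bounds come from the thickenings, the common point from nontriviality: if [p] and
    [p + 2 * d] lie in one interval, the other has points within [d] of each, hence contains the
    midpoint [p + d]. *)
Lemma thickening_overlaps_above d I J : 0 <= d ->
  points I `<=` thickening d J -> points J `<=` thickening d I ->
  ~ trivial_interval (2 * d) I \/ ~ trivial_interval (2 * d) J ->
  overlaps_above I (shift_interval_set d J).
Proof.
move=> d0 IJ JI ntriv; have dd0 : 0 <= 2 * d by lra.
have mid K L p : points K `<=` thickening d L -> points K p ->
    points K (p + 2 * d) -> points L (p + d).
  move=> KL /KL[s Ls]; rewrite ler_norml => /andP[? ?].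
  move=> /KL[u Lu]; rewrite ler_norml => /andP[? ?].
  by apply: (points_interval Ls Lu); apply/andP; split; lra.
split.
- case: ntriv => /not_trivial_intervalP -/(_ dd0)[p Kp Kpd].
    by exists p; split=> //=; apply: mid Kp Kpd.
  exists (p + d); split=> /=; first exact: mid Kp Kpd.
  by rewrite (_ : p + d + d = p + 2 * d) //; lra.
- move=> s /= /JI[t It]; rewrite ler_norml => /andP[? ?].
  by exists t => //; lra.
- move=> t /IJ[s Js]; rewrite ler_norml => /andP[? ?].
  by exists (s - d); [rewrite /= subrK | lra].
Qed.

(** For [0 <= d] the two bounds are automatic, and a common point of [I] and its shift is a point
    [p] of [I] with [p + d] in [I]. *)
Lemma overlaps_above_shift d I : 0 <= d ->
  overlaps_above I (shift_interval_set d I) <-> ~ trivial_interval d I.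
Proof.
move=> d0; rewrite not_trivial_intervalP //; split.
  by move=> [[p [Ip Ipd]] _ _]; exists p.
move=> [p Ip Ipd]; split; first by exists p.
  by move=> s Is; exists (s + d) => //; rewrite lerDl.
by move=> t It; exists (t - d); [rewrite /= subrK | rewrite gerBl].
Qed.

End Intervals.

(** * From matchings to interleavings *)

Section Matchings.
Variables (R : realType).

Lemma shift_bar_inj (X : Type) (d : R) : injective (@shift_bar R X d).
Proof.
move=> [I x] [J y] [IJ ->].
congr pair; apply: (@shift_interval_set_inj R d); apply: interval_set_eq.
exact: IJ.
Qed.

Lemma shift_barD (X : Type) (d e : R) (b : bar R X) :
  shift_bar d (shift_bar e b) = shift_bar (d + e) b.
Proof. by rewrite /shift_bar /= shift_interval_setD. Qed.

Definition overlap_part (X Y : Type) (d : R) (sigma : set (bar R X * bar R Y))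
    : set (bar R X * bar R Y) :=
  [set (p.1, shift_bar d p.2) | p in
    [set p | sigma p /\ overlaps_above p.1.1 (shift_bar d p.2).1]].

Lemma overlap_partE (X Y : Type) (d : R) (sigma : set (bar R X * bar R Y)) b c :
  overlap_part d sigma (b, shift_bar d c) <->
  sigma (b, c) /\ overlaps_above b.1 (shift_bar d c).1.
Proof.
split; last by exists (b, c).
by move=> [[b' c'] [/= s ov] /pair_equal_spec[<- /shift_bar_inj <-]].
Qed.

Lemma shift_matchingE (X Y : Type) (d : R) (f : set (bar R X * bar R Y)) b c :
  shift_matching d f (shift_bar d b, shift_bar d c) <-> f (b, c).
Proof.
split; last by exists (b, c).
by move=> [[b' c'] fbc /pair_equal_spec[/shift_bar_inj <- /shift_bar_inj <-]].
Qed.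

Lemma is_matchingV (T U : Type) (C : set T) (D : set U) (s : set (T * U)) :
  is_matching C D s -> is_matching D C (s^-1)%relation.
Proof.
move=> [sub fct inj]; split; first by move=> [c b] /sub[].
- by move=> c b b' sb sb'; apply: inj sb sb'.
- by move=> c c' b sc sc'; apply: fct sc sc'.
Qed.

Lemma delta_matchingV (X Y : Type) (d : R) (C : barcode R X) (D : barcode R Y)
    (s : set (bar R X * bar R Y)) :
  delta_matching d C D s -> delta_matching d D C (s^-1)%relation.
Proof.
move=> [sM sC sD sU]; split => //; first exact: is_matchingV.
by move=> c b /sU[].
Qed.

Lemma overlap_part_matching (X Y : Type) (d : R) (C : barcode R X)
    (D : barcode R Y) (s : set (bar R X * bar R Y)) :
  is_matching C D s ->
  overlap_matching C (shift_barcode d D) (overlap_part d s).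
Proof.
move=> [sub fct inj]; split; last by move=> _ _ [[b c] [_ ov]] [<- <-].
split.
- move=> _ [[b c] [/= /sub[/= Cb Dc] _]] <-; split => //.
  by exists c.
- move=> b _ _ [[b1 c1] [s1 _]] [<- <-] [[b2 c2] [s2 _]]
    /pair_equal_spec[/= b21 <-].
  by move: s1 s2; rewrite b21 => /fct /[apply] ->.
- move=> _ _ c [[b1 c1] [s1 _]] [<- <-] [[b2 c2] [s2 _]]
    /pair_equal_spec[/= <- /shift_bar_inj c21].
  by apply: inj s1 _; rewrite -c21.
Qed.

(** Going along [s] and back returns to the same bar by injectivity, so only pairs of a bar and its
    shift by [2 * d] arise, and the overlap condition in the composition selects the nontrivial
    ones. *)
Lemma overlap_part_comp (X Y : Type) (d : R) (C : barcode R X)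
    (D : barcode R Y) (s : set (bar R X * bar R Y)) : 0 <= d ->
  delta_matching d C D s ->
  overlap_comp (shift_matching d (overlap_part d (s^-1)%relation))
    (overlap_part d s) = transition C (2 * d).
Proof.
move=> d0 [[sub fct inj] sC sD sU]; have dd0 : 0 <= 2 * d by lra.
have dE : 2 * d = d + d by lra.
apply/seteqP; split=> [[b e]|_ [b [Cb ntriv] <-]].
  move=> [[/= _ [[b1 c1] [s1 _] [<- <-]]]] /=.
  move=> [[_ _]] [[c2 b2] [s2 _] [<- <-]]
    /pair_equal_spec[/= /shift_bar_inj c21 <-].
  rewrite /= c21 in s2 *.
  have -> : b2 = b1 by apply: inj s2 s1.
  rewrite shift_barD shift_interval_setD -dE.
  move=> /(overlaps_above_shift _ dd0) ntriv.
  by exists b1 => //; split => //; have [] := sub _ s1.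
have [c sbc] := sC _ Cb ntriv; have [bc cb] := sU _ _ sbc.
split; last exact/overlaps_above_shift.
exists (shift_bar d c) => /=.
  by apply/overlap_partE; split => //; apply: thickening_overlaps_above; auto.
rewrite dE -shift_barD; apply/shift_matchingE/overlap_partE; split => //.
by apply: thickening_overlaps_above; auto.
Qed.

Lemma delta_matching_interleaving (X Y : Type) (d : R) (C : barcode R X)
    (D : barcode R Y) (s : set (bar R X * bar R Y)) : 0 <= d ->
  delta_matching d C D s ->
  interleaving d C D (overlap_part d s) (overlap_part d (s^-1)%relation).
Proof.
move=> d0 sM; have [sm _ _ _] := sM; split.
- exact: overlap_part_matching.
- exact/overlap_part_matching/is_matchingV.
- exact: overlap_part_comp sM.
(* The second identity is the first one for the converse matching. *)
- have sVV : ((s^-1)^-1)%relation = s by apply/seteqP; split=> -[].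
  by rewrite -{1}sVV; apply: overlap_part_comp (delta_matchingV sM).
Qed.

(** * From interleavings to matchings *)

Lemma comp_unshiftE (X Y : Type) (d : R) (C : barcode R X) (D : barcode R Y)
    (f : set (bar R X * bar R Y)) b c :
  overlap_matching C (shift_barcode d D) f ->
  (unshift d D \; f)%relation (b, c) <-> f (b, shift_bar d c).
Proof.
move=> [[sub _ _] _].
split=> [[e fbc [c' _ /pair_equal_spec[/= ce <-]]]|fbc].
  by rewrite ce.
exists (shift_bar d c) => //; exists c => //.
by have [_ [c' Dc' /shift_bar_inj <-]] := sub _ fbc.
Qed.

(** All pairs of [f] overlap, so none is discarded. Hence the interleaving built from the matching
    has the given [f] as its first morphism. *)
Lemma overlap_part_unshift (X Y : Type) (d : R) (C : barcode R X)
    (D : barcode R Y) (f : set (bar R X * bar R Y)) :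
  overlap_matching C (shift_barcode d D) f ->
  overlap_part d (unshift d D \; f)%relation = f.
Proof.
move=> fM; have [[sub _ _] ov] := fM.
apply/seteqP; split=> [_ [[b c] [/(comp_unshiftE _ _ fM) fbc _]] <- //|].
move=> [b e] fbe.
have [_ [c _ /= ce]] := sub _ fbe; rewrite -ce in fbe *.
apply/overlap_partE; split; first exact/(comp_unshiftE _ _ fM).
exact: ov fbe.
Qed.

Lemma interleaving_sym (X Y : Type) (d : R) (C : barcode R X) (D : barcode R Y)
    (f : set (bar R X * bar R Y)) (g : set (bar R Y * bar R X)) :
  interleaving d C D f g -> interleaving d D C g f.
Proof. by case. Qed.

(** The transition relates [b] to its shift by [2 * d]; the bar [c] is read off from the
    intermediate bar of the composition. *)
Lemma interleaving_matched (X Y : Type) (d : R) (C : barcode R X)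
    (D : barcode R Y) (f : set (bar R X * bar R Y))
    (g : set (bar R Y * bar R X)) b :
  interleaving d C D f g -> C b -> ~ trivial_interval (2 * d) b.1 ->
  exists c, f (b, shift_bar d c) /\ g (c, shift_bar d b).
Proof.
move=> [_ _ gf _] Cb ntriv.
have : transition C (2 * d) (b, shift_bar (2 * d) b) by exists b.
rewrite -gf => -[[/= e fbe [[c b'] gcb /pair_equal_spec[/= ce b'E]]] _].
exists c; rewrite ce; split => //.
suff <- : b' = shift_bar d b by [].
apply: (@shift_bar_inj _ d); rewrite shift_barD b'E.
by congr shift_bar; lra.
Qed.

Lemma interleaving_delta_matching (X Y : Type) (d : R) (C : barcode R X)
    (D : barcode R Y) (f : set (bar R X * bar R Y))
    (g : set (bar R Y * bar R X)) : 0 <= d ->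
  interleaving d C D f g -> delta_matching d C D (unshift d D \; f)%relation.
Proof.
move=> d0 fg; have [fM gM _ _] := fg.
have [[fsub ffct finj] fov] := fM; have [_ gov] := gM.
have E b c := comp_unshiftE b c fM.
have fD b c : f (b, shift_bar d c) -> D c.
  by move=> /fsub[_ [c' Dc' /shift_bar_inj <-]].
split.
- split.
  + by move=> [b c] /E fbc; split; [have [] := fsub _ fbc | exact: fD fbc].
  + move=> b c c' /E fc /E fc'.
    by apply: (@shift_bar_inj _ d); apply: ffct fc fc'.
  + by move=> b b' c /E fb /E fb'; apply: finj fb fb'.
- move=> b Cb /(interleaving_matched fg Cb)[c [fbc _]].
  by exists c; apply/E.
- move=> c Dc /(interleaving_matched (interleaving_sym fg) Dc)[b [_ fbc]].
  by exists b; apply/E.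
- move=> b c /E fbc; apply: overlaps_above_thickening => //.
    exact: fov fbc.
  (* Whichever of [b] and [c] is nontrivial has a partner under both [f] and [g]; since [f] is
     functional and injective, that partner is the other one. *)
  move=> ntriv; suff /gov : g (c, shift_bar d b) by [].
  case: ntriv.
    have Cb : C b by have [] := fsub _ fbc.
    move=> /(interleaving_matched fg Cb)[c' [fbc' gcb]].
    by rewrite (@shift_bar_inj _ d _ _ (ffct _ _ _ fbc fbc')).
  move=> /(interleaving_matched (interleaving_sym fg) (fD _ _ fbc)).
  by move=> [b' [gcb fbc']]; rewrite (finj _ _ _ fbc fbc').
Qed.

End Matchings.

Theorem proposition4p3 (R : realType) (X Y : Type)
    (C : barcode R X) (D : barcode R Y) :
  (forall d : R, 0 <= d ->
   forall f : set (bar R X * bar R Y),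
     overlap_matching C (shift_barcode d D) f ->
     (interleaving_morphism d C D f <->
      delta_matching d C D (unshift d D \; f)%relation)) /\
  interleaving_distance C D = bottleneck_distance C D.
Proof.
split=> [d d0 f fM|].
  split=> [[g fg]|/(delta_matching_interleaving d0)].
    exact: interleaving_delta_matching fg.
  by rewrite (overlap_part_unshift fM) => ?; eexists; eassumption.
(* The infima agree because the two sets of admissible [d] coincide. *)
rewrite /interleaving_distance /bottleneck_distance; congr ereal_inf.
apply/seteqP; split=> _ [d [d0 +] <-].
  move=> [f [g fg]]; exists d => //; split => //.
  by eexists; apply: interleaving_delta_matching fg.
move=> [s /(delta_matching_interleaving d0) fg]; exists d => //.
by split => //; do 2 eexists; exact: fg.
Qed.
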